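(* Let $(M,g,\sigma)$ be a magnetic system of geodesic type. Then for every energy value $\kappa\in(0,\infty)$ there exists at least one periodic orbit of the magnetic geodesic flow $\Phi^t_{g,\sigma}$ with energy $\kappa$.
   Context: A magnetic system $(M,g,\sigma)$ consists of a closed connected Riemannian manifold $(M,g)$ and a closed two-form $\sigma$ on $M$. Its Lorentz force is the bundle endomorphism $Y:TM\to TM$ defined by $g_q(Y_qu,v)=\sigma_q(u,v)$. A magnetic geodesic is a smooth curve $\gamma:\mathbb R\to M$ with $\nabla_{\dot\gamma}\dot\gamma=Y_\gamma\dot\gamma$ ($\nabla$ the Levi-Civita connection of $g$). The magnetic geodesic flow is $\Phi^t_{g,\sigma}:TM\to TM$, $(q,v)\mapsto(\gamma_{q,v}(t),\dot\gamma_{q,v}(t))$, where $\gamma_{q,v}$ is the magnetic geodesic with initial condition $(q,v)$. The energy is $E(q,v)=\frac12 g_q(v,v)$; it is constant along the flow. A smooth embedded loop is a smooth embedding $\gamma:\mathbb R/T\mathbb Z\to M$ for some $T>0$, also viewed as a $T$-periodic map on $\mathbb R$. $(M,g,\sigma)$ is of geodesic type if there is a smooth embedded loop $\gamma$ in $M$ that is a geodesic of $(M,g)$ and satisfies $\dot\gamma(t)\in\ker\sigma_{\gamma(t)}=\{v\in T_{\gamma(t)}M:\sigma_{\gamma(t)}(v,w)=0\ \forall w\in T_{\gamma(t)}M\}$ for all $t$. *)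

(* Defs.v *)
From HB Require Import structures.
From mathcomp Require Import all_boot all_order all_algebra.
From mathcomp Require Import ring.
From mathcomp Require Import all_classical all_reals all_analysis.
Set Implicit Arguments.
Unset Strict Implicit.
Unset Printing Implicit Defensive.
Import Order.TTheory GRing.Theory Num.Theory.
Import numFieldNormedType.Exports.
Local Open Scope classical_set_scope.
Local Open Scope ring_scope.

Section Smooth.
Context {R : realType} {n : nat} {V : normedModType R}.

Definition partial (a : 'I_n) (f : 'rV[R]_n -> V) : 'rV[R]_n -> V :=
  fun x => 'D_(delta_mx 0 a) f x.

(* C^oo on the open set D: every iterated partial derivative is Frechet
   differentiable at every point of D. *)
Definition smooth_on (D : set 'rV[R]_n) (f : 'rV[R]_n -> V) :=
  forall (s : seq 'I_n) x, D x -> differentiable (foldr partial f s) x.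

End Smooth.

(* A smooth n-manifold without boundary, given by an atlas, which need not be
   maximal. [chart i] and [param i] are total functions; their values outside
   [chart_dom i] and outside its image are irrelevant. [chart_at] singles out a
   chart around each point; it serves to coordinatize the tangent spaces. *)
Record manifold (R : realType) (n : nat) := Manifold {
  mpoint :> topologicalType ;
  chart_index : Type ;
  chart_dom : chart_index -> set mpoint ;
  chart : chart_index -> mpoint -> 'rV[R]_n ;
  param : chart_index -> 'rV[R]_n -> mpoint ;
  chart_at : mpoint -> chart_index ;
  manifold_hausdorff : hausdorff_space mpoint ;
  manifold_second_countable : @second_countable mpoint ;
  chart_atP : forall p, chart_dom (chart_at p) p ;
  open_chart_dom : forall i, open (chart_dom i) ;
  open_chart_img : forall i, open (chart i @` chart_dom i) ;
  chartK : forall i p, chart_dom i p -> param i (chart i p) = p ;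
  chart_continuous : forall i p, chart_dom i p -> {for p, continuous (chart i)} ;
  param_continuous : forall i x, (chart i @` chart_dom i) x ->
    {for x, continuous (param i)} ;
  transition_smooth : forall i j,
    smooth_on (chart i @` (chart_dom i `&` chart_dom j)) (chart j \o param i)
}.

Section Tangent.
Context {R : realType} {n : nat} (M : manifold R n).

Definition chart_img (i : chart_index M) : set 'rV[R]_n :=
  chart i @` chart_dom i.

(* The tangent space at p is R^n, a vector being identified with its components
   in the chart [chart_at p]. *)
Definition tangent (p : M) : normedModType R := 'rV[R]_n.

Definition TM := {p : M & tangent p}.

(* The coordinate vector field d/dx^a of the chart i, at p. *)
Definition coord_vec (i : chart_index M) (p : M) (a : 'I_n) : tangent p :=
  'd (chart (chart_at p) \o param i) (chart i p) (delta_mx 0 a).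

Definition cotensor2 := forall p : M, tangent p -> tangent p -> R.

Definition bilinear2 (h : cotensor2) :=
  forall p, (forall u, scalar (h p u)) /\ (forall v, scalar (fun u => h p u v)).

Definition component (h : cotensor2) (i : chart_index M) (a b : 'I_n)
    (x : 'rV[R]_n) : R :=
  h (param i x) (coord_vec i (param i x) a) (coord_vec i (param i x) b).

Definition smooth_cotensor2 (h : cotensor2) :=
  forall i a b, smooth_on (chart_img i) (component h i a b).

Record is_riemannian_metric (g : cotensor2) : Prop := {
  metric_bilinear : bilinear2 g ;
  metric_sym : forall p u v, g p u v = g p v u ;
  metric_pos : forall p u, u != 0 -> 0 < g p u u ;
  metric_smooth : smooth_cotensor2 g
}.

Record is_closed_two_form (s : cotensor2) : Prop := {
  form_bilinear : bilinear2 s ;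
  form_alt : forall p u, s p u u = 0 ;
  form_smooth : smooth_cotensor2 s ;
  form_closed : forall i a b c x, chart_img i x ->
    partial a (component s i b c) x + partial b (component s i c a) x
      + partial c (component s i a b) x = 0
}.

Definition smooth_curve (c : R -> M) :=
  continuous c /\
  forall i t k, chart_dom i (c t) -> derivable (derive1n k (chart i \o c)) t 1.

Definition velocity (c : R -> M) (t : R) : tangent (c t) :=
  derive1 (chart (chart_at (c t)) \o c) t.

Definition lift (c : R -> M) (t : R) : TM := existT _ (c t) (velocity c t).

(* A smooth embedding of R/TZ, viewed as a T-periodic map on R: an injective
   immersion that is a homeomorphism onto its image. T-invariant open subsets
   of R are the open subsets of R/TZ. *)
Record embedded_loop (T : R) (c : R -> M) : Prop := {
  loop_period_gt0 : 0 < T ;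
  loop_smooth : smooth_curve c ;
  loop_periodic : forall t, c (t + T) = c t ;
  loop_injective : forall s t, c s = c t -> exists k : int, s = t + k%:~R * T ;
  loop_immersion : forall t, velocity c t != 0 ;
  loop_embedding : forall A : set R, open A -> (forall t, A (t + T) <-> A t) ->
    exists2 W : set M, open W & forall t, A t <-> W (c t)
}.

End Tangent.

Section LeviCivita.
Context {R : realType} {n : nat} {M : manifold R n}.
Context (g : cotensor2 M).

Definition gram (i : chart_index M) (x : 'rV[R]_n) : 'M[R]_n :=
  \matrix_(a, b) component g i a b x.

(* Gamma^k_ab = 1/2 g^{kl} (d_a g_bl + d_b g_al - d_l g_ab). *)
Definition christoffel (i : chart_index M) (x : 'rV[R]_n) (k a b : 'I_n) : R :=
  2^-1 * \sum_l invmx (gram i x) k l *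
    (partial a (component g i b l) x + partial b (component g i a l) x
     - partial l (component g i a b) x).

Lemma christoffel_torsion_free (gP : is_riemannian_metric g) i x k a b :
  christoffel i x k a b = christoffel i x k b a.
Proof.
congr (_ * _); apply: eq_bigr => l _; congr (_ * (_ - _)); first exact: addrC.
by congr (partial l _ x); apply/funext => y; rewrite /component metric_sym.
Qed.

Lemma christoffel_metric (gP : is_riemannian_metric g) i x a b c :
  gram i x \in unitmx ->
  partial a (component g i b c) x =
    \sum_l (christoffel i x l a b * component g i l c x
            + christoffel i x l a c * component g i b l x).
Proof.
move=> Gu.
have gC d e : component g i d e = component g i e d.
  by apply/funext => y; rewrite /component metric_sym.
have lower d e f : \sum_l christoffel i x l d e * component g i l f x =
    2^-1 * (partial d (component g i e f) x + partial e (component g i d f) x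
            - partial f (component g i d e) x).
  pose w := \row_m (partial d (component g i e m) x
    + partial e (component g i d m) x - partial m (component g i d e) x).
  have GT : (gram i x)^T = gram i x.
    by apply/matrixP => p q; rewrite !mxE gC.
  transitivity (2^-1 * w 0 f); last by rewrite mxE.
  rewrite -[w](mulmxKV Gu) mxE mulr_sumr; apply: eq_bigr => l _.
  rewrite mxE [gram i x l f]mxE mulrA; congr (_ * _ * _).
  apply: eq_bigr => m _.
  by rewrite mxE mulrC -[in RHS]GT -trmx_inv mxE.
rewrite big_split /= lower.
under eq_bigr do rewrite (gC b).
rewrite lower (gC c b); set A := partial _ _ _; set B := partial _ _ _.
set C := partial _ _ _.
rewrite -mulrDr.
have -> : A + B - C + (A + C - B) = 2 * A by ring.
by rewrite mulKf // pnatr_eq0.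
Qed.

(* nabla_{c'} c' at time t. *)
Definition covariant_acceleration (c : R -> M) (t : R) : tangent (c t) :=
  let i := chart_at (c t) in
  let x := chart i \o c in
  derive1n 2 x t +
  \row_k \sum_a \sum_b
    christoffel i (x t) k a b * derive1 x t 0 a * derive1 x t 0 b.

Definition geodesic (c : R -> M) :=
  smooth_curve c /\ forall t, covariant_acceleration c t = 0.

End LeviCivita.

Record magnetic_system (R : realType) (n : nat) := MagneticSystem {
  msys :> manifold R n ;
  metric : cotensor2 msys ;
  form : cotensor2 msys ;
  msys_compact : compact [set: msys] ;
  msys_connected : connected [set: msys] ;
  metricP : is_riemannian_metric metric ;
  formP : is_closed_two_form form
}.

Section Magnetic.
Context {R : realType} {n : nat} (S : magnetic_system R n).

(* The vector w with g(w, v) = s(u, v) for all v. *)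
Definition lorentz_force (p : S) (u : tangent p) : tangent p :=
  xget 0 [set w : tangent p | forall v, metric w v = form u v].

Lemma lorentz_forceP (p : S) (u v : tangent p) :
  metric (lorentz_force u) v = form u v.
Proof.
have [/(_ p)[gl gr] gC gpos _] := metricP S.
have [/(_ p)[sl _] _ _ _] := formP S.
have expand (h : tangent p -> R) : scalar h -> forall w : tangent p,
    h w = \sum_a w 0 a * h (delta_mx 0 a).
  move=> hl w; rewrite {1}(row_sum_delta w).
  pose H : {scalar 'rV[R]_n} := HB.pack h
    (GRing.isLinear.Build R 'rV[R]_n R *%R h hl).
  rewrite -[h _]/(H _) linear_sum; apply: eq_bigr => a _.
  by rewrite linearZ.
pose G : 'M[R]_n :=
  \matrix_(a, b) metric (delta_mx 0 a : tangent p) (delta_mx 0 b).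
have gG (w : tangent p) b : metric w (delta_mx 0 b) = (w *m G) 0 b.
  rewrite (expand (fun u => metric u _) (gr _)) mxE.
  by apply: eq_bigr => a _; rewrite mxE.
have Gu : G \in unitmx.
  rewrite -row_free_unit; apply/inj_row_free => w wG0.
  apply/eqP; apply: contraT => /(gpos p); rewrite (expand _ (gl w)).
  by rewrite big1 ?ltxx // => b _; rewrite gG wG0 mxE mulr0.
suff ex : exists w : tangent p, forall v, metric w v = form u v.
  exact: (@xgetPex (tangent p) 0 [set w | forall v, metric w v = form u v] ex).
exists ((\row_b form u (delta_mx 0 b : tangent p)) *m invmx G) => w /=.
rewrite (expand _ (gl _)) (expand _ (sl u)).
by apply: eq_bigr => b _; rewrite gG mulmxKV // mxE.
Qed.

Definition magnetic_geodesic (c : R -> S) :=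
  smooth_curve c /\
  forall t, covariant_acceleration (@metric _ _ S) c t =
            lorentz_force (velocity c t).

(* The graph of Phi^t. *)
Definition magnetic_flow (t : R) (x y : TM S) :=
  exists c : R -> S, [/\ magnetic_geodesic c, lift c 0 = x & lift c t = y].

Definition energy (x : TM S) : R := 2^-1 * metric (projT2 x) (projT2 x).

Definition periodic_orbit (z : R -> TM S) :=
  (forall s t, magnetic_flow t (z s) (z (s + t))) /\
  exists2 T, 0 < T & forall t, z (t + T) = z t.

Definition geodesic_type :=
  exists (T : R) (c : R -> S), [/\ embedded_loop T c,
    geodesic (@metric _ _ S) c &
    forall t (w : tangent (c t)), form (velocity c t) w = 0].

End Magnetic.

(* Main.v *)
Require Import Defs.
From HB Require Import structures.
From mathcomp Require Import all_boot all_order all_algebra.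
From mathcomp Require Import ring.
From mathcomp Require Import all_classical all_reals all_analysis.
Import Order.TTheory GRing.Theory Num.Theory.
Import numFieldNormedType.Exports.
Local Open Scope classical_set_scope.
Local Open Scope ring_scope.

(** Where the velocity lies in the kernel of the form, the Lorentz force
    vanishes, so the given closed geodesic is a magnetic geodesic, and so is
    each of its affine reparametrizations. The speed of a geodesic is constant,
    since the Levi-Civita connection is compatible with the metric, and it is
    nonzero for an immersion; rescaling time therefore reaches every positive
    energy. *)

(** * Derivatives along curves in normed spaces, and expansions of linear maps *)

Section Calculus.
Context {R : realType}.

Lemma is_derive_diff_comp (V W : normedModType R) (F : V -> W) (x : R -> V)
    (t : R) (dx : V) :
  differentiable F (x t) -> is_derive t 1 x dx ->
  is_derive t 1 (F \o x) ('d F (x t) dx).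
Proof.
move=> dF [xt <-].
have dxt : differentiable x t by exact/derivable1_diffP.
have dFx : differentiable (F \o x) t by exact: differentiable_comp.
apply: DeriveDef; first exact: diff_derivable.
by rewrite deriveE // diff_comp // deriveE.
Qed.

Lemma is_derive_affine_comp (V : normedModType R) (f : R -> V) (l m t : R)
    (df : V) :
  is_derive (l * t + m) 1 f df ->
  is_derive t 1 (fun u => f (l * u + m)) (l *: df).
Proof.
move=> fP; have [fd fE] := fP.
have aP : is_derive t 1 (fun u : R => l * u + m) l.
  have := @is_deriveD R R R (l \*: (id : R -> R)) (cst m) t 1 (l *: 1) 0
    (is_deriveZ _ (is_derive_id _ _)) (is_derive_cst _ _ _).
  by rewrite addr0 [l *: 1]mulr1.
have := is_derive_diff_comp _ _ f (fun u : R => l * u + m) t l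
  (iffLR (derivable1_diffP _ _) fd) aP.
by rewrite deriv1E // derive1E fE.
Qed.

Lemma row_linearE {n} (V : lmodType R) (h : {linear 'rV[R]_n -> V})
    (w : 'rV[R]_n) :
  h w = \sum_a w 0 a *: h (delta_mx 0 a).
Proof.
by rewrite {1}(row_sum_delta w) linear_sum; apply: eq_bigr => a _; rewrite linearZ.
Qed.

Lemma scalar_scaleE (V : lmodType R) (h : V -> R) (a : R) (u : V) :
  scalar h -> h (a *: u) = a * h u.
Proof.
(* The instance at -1, 0, 0 yields [h 0 = 0], which removes the additive term left by the instance
   at [a], [u], 0. *)
move=> hl; have := hl a u 0; have := hl (-1) 0 0.
by rewrite !scaler0 !addr0 mulN1r addNr => ->; rewrite addr0.
Qed.

Lemma is_derive_coord {m n} (f : R -> 'M[R]_(m, n)) (t : R) df i j :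
  is_derive t 1 f df -> is_derive t 1 (fun u => f u i j) (df i j).
Proof.
move=> [fd <-]; apply: DeriveDef; first by move/derivable_mxP : fd.
by rewrite derive_mx // mxE.
Qed.

Lemma is_derive_sum_fun {n} (f : 'I_n -> R -> R) (df : 'I_n -> R) (t : R) :
  (forall a, is_derive t 1 (f a) (df a)) ->
  is_derive t 1 (fun u => \sum_a f a u) (\sum_a df a).
Proof.
move=> fP; have -> : (fun u => \sum_a f a u) = \sum_a f a.
  by apply/funext => u; rewrite fct_sumE.
exact: is_derive_sum.
Qed.

End Calculus.

(** * Curves in charts and their affine changes of time *)

Section Charts.
Context {R : realType} {n : nat} {M : manifold R n}.

(** The composite is known to be the identity only on the chart image; this set is open, so the two
    maps agree near [chart i p] and have the same derivative there. *)
Lemma diff_transition_id (i : chart_index M) (p : M) (v : 'rV[R]_n) :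
  chart_dom i p -> 'd (chart i \o param i) (chart i p) v = v.
Proof.
move=> ip.
have iip : (chart i @` (chart_dom i `&` chart_dom i)) (chart i p).
  by exists p.
have := transition_smooth [::] iip => /= dd.
rewrite -deriveE // -[RHS](derive_id (chart i p) v); apply: near_eq_derive.
have : nbhs (chart i p) (chart i @` chart_dom i).
  by apply: open_nbhs_nbhs; split; [exact: open_chart_img|exists p].
by apply: filterS => _ [q iq <-] /=; rewrite chartK.
Qed.

Lemma coord_vec_chart_at (p : M) (a : 'I_n) :
  coord_vec (chart_at p) p a = delta_mx 0 a.
Proof. by rewrite /coord_vec diff_transition_id //; exact: chart_atP. Qed.

Lemma near_chart_dom (c : R -> M) (i : chart_index M) (t : R) :
  continuous c -> chart_dom i (c t) -> \forall u \near t, chart_dom i (c u).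
Proof.
move=> cc it; apply: cc; apply: open_nbhs_nbhs; split => //.
exact: open_chart_dom.
Qed.

Lemma is_derive_smooth_curve (c : R -> M) (i : chart_index M) (t : R) k :
  smooth_curve c -> chart_dom i (c t) ->
  is_derive t 1 (derive1n k (chart i \o c)) (derive1n k.+1 (chart i \o c) t).
Proof.
move=> [_ cs] it; rewrite derive1nS derive1E.
by apply: derivableP; exact: cs.
Qed.

(** [velocity] is written in the chart [chart_at (c t)], which may jump with [t]. The chain rule for
    the transition map moves it to one fixed chart, where it can be differentiated in time. *)
Lemma velocityE (c : R -> M) (i : chart_index M) (t : R) :
  smooth_curve c -> chart_dom i (c t) ->
  velocity c t =
    \sum_a derive1 (chart i \o c) t 0 a *: coord_vec i (c t) a.
Proof.
move=> cs it; set j := chart_at (c t).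
have jt : chart_dom j (c t) by exact: chart_atP.
have ijt : (chart i @` (chart_dom i `&` chart_dom j)) (chart i (c t)).
  by exists (c t).
have := transition_smooth [::] ijt => /= dF.
have xP := is_derive_smooth_curve c i t 0 cs it.
have [_ E] := is_derive_diff_comp _ _ _ (chart i \o c) _ _ dF xP.
rewrite -(row_linearE _ ('d (chart j \o param i) (chart i (c t)))) -E.
rewrite /velocity derive1E; apply: near_eq_derive.
apply: filterS (near_chart_dom c i t cs.1 it) => u iu /=.
by rewrite chartK.
Qed.

Section Reparametrization.
Context (c : R -> M) (cs : smooth_curve c) (l m : R).

Lemma continuous_affine_curve : continuous (fun u => c (l * u + m)).
Proof.
move=> u; apply: (@continuous_comp _ _ _ (fun u : R => l * u + m) c).
  apply: continuousD; last exact: cst_continuous.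
  exact: mulrl_continuous.
exact: cs.1.
Qed.

(** Since the chart domain is open, the formula of order [k] holds at all times near [t] and can be
    differentiated again; each differentiation brings out one more factor [l]. *)
Lemma is_derive_affine_curve (i : chart_index M) k (t : R) :
  chart_dom i (c (l * t + m)) ->
  is_derive t 1 (derive1n k (chart i \o (fun u => c (l * u + m))))
    (l ^+ k.+1 *: derive1n k.+1 (chart i \o c) (l * t + m)).
Proof.
elim: k t => [|k IHk] t it.
  rewrite expr1; apply: (is_derive_affine_comp _ (chart i \o c)).
  exact: (is_derive_smooth_curve c i _ 0 cs it).
have /near_eq_is_derive : \near t,
    l ^+ k.+1 *: derive1n k.+1 (chart i \o c) (l * t + m) =
    derive1n k.+1 (chart i \o (fun u => c (l * u + m))) t.
  apply: filterS (near_chart_dom _ i t continuous_affine_curve it) => u /IHk [_ <-].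
  by rewrite derive1nS derive1E.
apply; rewrite [in X in is_derive _ _ _ X]exprSr -scalerA.
apply: (@is_deriveZ _ _ _
  (fun u => derive1n k.+1 (chart i \o c) (l * u + m))).
apply: (is_derive_affine_comp _ (derive1n k.+1 (chart i \o c))).
exact: is_derive_smooth_curve.
Qed.

Lemma derive1n_affine_curve (i : chart_index M) k (t : R) :
  chart_dom i (c (l * t + m)) ->
  derive1n k (chart i \o (fun u => c (l * u + m))) t =
    l ^+ k *: derive1n k (chart i \o c) (l * t + m).
Proof.
case: k => [|k] it; first by rewrite expr0 scale1r.
by have [_ <-] := is_derive_affine_curve i k t it; rewrite derive1nS derive1E.
Qed.

Lemma smooth_affine_curve : smooth_curve (fun u => c (l * u + m)).
Proof.
split=> [|i t k it]; first exact: continuous_affine_curve.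
by have [] := is_derive_affine_curve i k t it.
Qed.

Lemma velocity_affine (t : R) :
  velocity (fun u => c (l * u + m)) t = l *: velocity c (l * t + m).
Proof.
have := derive1n_affine_curve _ 1 t (chart_atP (c (l * t + m))).
by rewrite expr1.
Qed.

(** The second derivative acquires the factor [l ^+ 2], and so does the Christoffel term, being
    quadratic in the first derivative. *)
Lemma covariant_acceleration_affine (g : cotensor2 M) (t : R) :
  covariant_acceleration g (fun u => c (l * u + m)) t =
  l ^+ 2 *: covariant_acceleration g c (l * t + m).
Proof.
have ct := chart_atP (c (l * t + m)).
have := derive1n_affine_curve _ 1 t ct; rewrite !derive1n1 expr1 => E1.
rewrite /covariant_acceleration E1 (derive1n_affine_curve _ 2 t ct) scalerDr.
congr (_ + _); apply/rowP => k; rewrite !mxE mulr_sumr.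
apply: eq_bigr => a _; rewrite mulr_sumr; apply: eq_bigr => b _.
by rewrite !mxE /=; ring.
Qed.

End Reparametrization.
End Charts.

(** * Constancy of the speed of a geodesic *)

Section Speed.
Context {R : realType} {n : nat} {M : manifold R n} (g : cotensor2 M)
  (gP : is_riemannian_metric g).

Lemma bilinear2_sumE (h : cotensor2 M) (p : M) (v : 'I_n -> R)
    (e : 'I_n -> tangent p) : bilinear2 h ->
  h p (\sum_a v a *: e a) (\sum_a v a *: e a) =
  \sum_a \sum_b h p (e a) (e b) * v a * v b.
Proof.
move=> /(_ p) [hl hr].
have lin (f : tangent p -> R) : scalar f ->
    f (\sum_a v a *: e a) = \sum_a v a * f (e a).
  move=> fl.
  pose F : {scalar 'rV[R]_n} := HB.pack f
    (GRing.isLinear.Build R 'rV[R]_n R *%R f fl).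
  rewrite -[f _]/(F _) linear_sum; apply: eq_bigr => a _.
  by rewrite linearZ.
rewrite (lin (fun u => h p u _) (hr _)); apply: eq_bigr => a _.
rewrite (lin _ (hl _)) mulr_sumr; apply: eq_bigr => b _; ring.
Qed.

Lemma speedE (c : R -> M) (i : chart_index M) (t : R) :
  smooth_curve c -> chart_dom i (c t) ->
  g (c t) (velocity c t) (velocity c t) =
  \sum_a \sum_b component g i a b (chart i (c t))
    * derive1 (chart i \o c) t 0 a * derive1 (chart i \o c) t 0 b.
Proof.
move=> cs it; rewrite (velocityE c i) // bilinear2_sumE; last first.
  by case: gP.
by apply: eq_bigr => a _; apply: eq_bigr => b _; rewrite /component chartK.
Qed.

(** In its own chart the coordinate vectors at [p] form the standard basis, so a row vector [w] with
    [w *m G = 0], for [G] the Gram matrix, satisfies g(w, w) = 0 and vanishes by positivity. *)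
Lemma gram_chart_at_unit (p : M) :
  gram g (chart_at p) (chart (chart_at p) p) \in unitmx.
Proof.
rewrite -row_free_unit; apply/inj_row_free => w wG0.
apply/eqP; apply: contraT => w0; have := metric_pos gP (p := p) w0.
rewrite (row_sum_delta w) bilinear2_sumE; last by case: gP.
rewrite exchange_big big1 ?ltxx// => b _ /=.
have /rowP /(_ b) := wG0; rewrite !mxE => E.
rewrite -mulr_suml -[RHS](mul0r (w 0 b)) -[in RHS]E; congr (_ * _).
apply: eq_bigr => a _; rewrite mxE /component chartK; last exact: chart_atP.
by rewrite !coord_vec_chart_at mulrC.
Qed.

(* The left-hand side is d/dt g(x', x') in coordinates, with v = x', w = x''.
   Metric compatibility splits its first term into two copies of one Christoffel
   sum, which cancel the two terms in w. *)
Lemma metric_geodesic_identity (p : M) (i := chart_at p) (x := chart i p)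
    (v w : 'rV[R]_n) :
  w + \row_k \sum_a \sum_b christoffel g i x k a b * v 0 a * v 0 b = 0 ->
  \sum_a \sum_b ((\sum_e v 0 e * partial e (component g i a b) x) * v 0 a * v 0 b
     + component g i a b x * w 0 a * v 0 b
     + component g i a b x * v 0 a * w 0 b) = 0.
Proof.
move=> /eqP; rewrite addr_eq0 => /eqP ->.
have Gu := gram_chart_at_unit p.
have gC d e : component g i d e x = component g i e d x.
  by rewrite /component (Defs.metric_sym gP).
pose A := \sum_a \sum_b \sum_e \sum_l
  christoffel g i x l e a * component g i l b x * v 0 e * v 0 a * v 0 b.
have A1 : A = \sum_a \sum_b component g i a b x *
    (\sum_e \sum_l christoffel g i x a e l * v 0 e * v 0 l) * v 0 b.
  rewrite /A exchange_big [RHS]exchange_big; apply: eq_bigr => b _ /=.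
  under [RHS]eq_bigr do (rewrite mulr_sumr mulr_suml;
    under eq_bigr do rewrite mulr_sumr mulr_suml).
  under eq_bigr do rewrite exchange_big.
  rewrite exchange_big; apply: eq_bigr => l _ /=.
  rewrite exchange_big; apply: eq_bigr => e _ /=.
  by apply: eq_bigr => a _; ring.
have A2 : A = \sum_a \sum_b component g i a b x * v 0 a *
    (\sum_e \sum_l christoffel g i x b e l * v 0 e * v 0 l).
  rewrite A1 exchange_big; apply: eq_bigr => b _; apply: eq_bigr => a _ /=.
  by rewrite gC; ring.
have A3 : \sum_a \sum_b
    ((\sum_e v 0 e * partial e (component g i a b) x) * v 0 a * v 0 b) = A + A.
  rewrite {2}/A [X in _ + X]exchange_big -big_split /=; apply: eq_bigr => a _.
  rewrite -big_split; apply: eq_bigr => b _ /=.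
  rewrite -big_split !mulr_suml; apply: eq_bigr => e _ /=.
  rewrite -big_split (christoffel_metric gP) // mulr_sumr !mulr_suml.
  by apply: eq_bigr => l _ /=; rewrite (gC a l); ring.
under eq_bigr do rewrite !big_split /=.
rewrite !big_split /= A3 {1}A1 {1}A2 -!big_split big1 //= => a _.
rewrite -!big_split big1 //= => b _.
by rewrite !mxE; ring.
Qed.

Lemma is_derive_speed (c : R -> M) (t : R) : geodesic g c ->
  is_derive t 1 (fun u => g (c u) (velocity c u) (velocity c u)) 0.
Proof.
move=> [cs cg]; set i := chart_at (c t).
have it : chart_dom i (c t) by exact: chart_atP.
set x := chart i \o c.
have x1 : is_derive t 1 x (derive1 x t).
  exact: (is_derive_smooth_curve c i t 0 cs it).
have x2 : is_derive t 1 (derive1 x) (derive1n 2 x t).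
  exact: (is_derive_smooth_curve c i t 1 cs it).
(* The chart [i] is frozen at time [t]; the coordinate formula for the squared speed stays valid at
   nearby times. *)
have : \near t, \sum_a \sum_b component g i a b (x t)
    * derive1 x t 0 a * derive1 x t 0 b = g (c t) (velocity c t) (velocity c t).
  apply: filterS (near_chart_dom c i t cs.1 it) => u iu.
  by rewrite (speedE c i).
move/near_eq_is_derive; apply.
(* [covariant_acceleration] at [t] is written in the chart [i], so [cg t] is by definition the
   hypothesis of the identity. It remains to match its left-hand side with the product rule. *)
apply: (is_derive_eq _
  (metric_geodesic_identity (c t) (derive1 x t) (derive1n 2 x t) (cg t))).
apply: (is_derive_sum_fun (fun a u => \sum_b component g i a b (x u)
    * derive1 x u 0 a * derive1 x u 0 b)) => a.
apply: (is_derive_sum_fun (fun b u => component g i a b (x u)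
    * derive1 x u 0 a * derive1 x u 0 b)) => b.
have dg : differentiable (component g i a b) (x t).
  by apply: (metric_smooth gP a b [::]); exists (c t).
have gx := is_derive_diff_comp _ _ _ _ _ _ dg x1.
have xa := is_derive_coord _ _ _ 0 a x2.
have xb := is_derive_coord _ _ _ 0 b x2.
apply: is_derive_eq (is_deriveM (is_deriveM gx xa) xb) _.
rewrite (row_linearE _ ('d (component g i a b) (x t))).
have -> : \sum_e derive1 x t 0 e *: 'd (component g i a b) (x t) (delta_mx 0 e) =
    \sum_e derive1 x t 0 e * partial e (component g i a b) (x t).
  by apply: eq_bigr => e _; rewrite /partial deriveE.
rewrite -/i -[chart i (c t)]/(x t) mulrfctE /GRing.scale /=.
ring.
Qed.

Lemma geodesic_speed_constant (c : R -> M) (s t : R) : geodesic g c ->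
  g (c s) (velocity c s) (velocity c s) = g (c t) (velocity c t) (velocity c t).
Proof.
move=> cg.
exact: (@is_derive_0_is_cst R (fun u => g (c u) (velocity c u) (velocity c u)) s t
  (fun u => is_derive_speed c u cg)).
Qed.

End Speed.

(** * Magnetic geodesics of prescribed energy *)

Lemma lorentz_force_eq0 (R : realType) (n : nat) (S : magnetic_system R n)
    (p : S) (u : tangent p) :
  (forall v : tangent p, Defs.form u v = 0) -> lorentz_force u = 0.
Proof.
(* Pairing the force w with itself gives g(w, w) = s(u, w) = 0, for s the two-form. *)
move=> u0; apply/eqP; apply: contraT => /(metric_pos (metricP S)).
by rewrite lorentz_forceP u0 ltxx.
Qed.

Theorem proposition1 (R : realType) (n : nat) (S : magnetic_system R n)
    (hS : geodesic_type S) (kappa : R) (hkappa : 0 < kappa) :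
  exists z : R -> TM S,
    periodic_orbit z /\ forall t, energy (z t) = kappa.
Proof.
have [T [c [loop cg cker]]] := hS.
have [T0 cs cT _ cimm _] := loop.
pose E := Defs.metric (velocity c 0) (velocity c 0).
have E0 : 0 < E by apply: (metric_pos (metricP S)); exact: cimm.
(* The time scale solves [l ^+ 2 * E / 2 = kappa]. *)
pose l := Num.sqrt (2 * kappa / E).
have l0 : 0 < l by rewrite sqrtr_gt0 divr_gt0 // mulr_gt0.
(* The lift of every reparametrization with factor [l] runs through [W], whatever the shift [m]. *)
pose W (u : R) : TM S := existT _ (c u) (l *: velocity c u).
have liftE m u : Defs.lift (fun u => c (l * u + m)) u = W (l * u + m).
  by rewrite /Defs.lift velocity_affine.
have mag m : magnetic_geodesic (fun u : R => c (l * u + m)).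
  split=> [|t]; first exact: smooth_affine_curve.
  rewrite covariant_acceleration_affine // cg.2 scaler0.
  rewrite lorentz_force_eq0 // => v; rewrite velocity_affine //.
  have [_ /(_ v) fl] := form_bilinear (formP S) (c (l * t + m)).
  by rewrite (scalar_scaleE _ _ _ _ fl) cker mulr0.
have liftT u : Defs.lift c (u + T) = Defs.lift c u.
  (* The two velocities lie in tangent spaces at [c (u + T)] and [c u]. Viewing [c] as its own
     translate compares the lifts without transport between these types. *)
  have cE : c = (fun u => c (1 * u + T)) by apply/funext => w; rewrite mul1r cT.
  by rewrite [in RHS]cE /Defs.lift velocity_affine // scale1r mul1r.
exists (fun s => W (l * s)); split; last first.
  move=> t; rewrite /energy /=.
  have [gl gr] := metric_bilinear (metricP S) (c (l * t)).
  rewrite (scalar_scaleE _ (fun u => Defs.metric u _) _ _ (gr _)).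
  rewrite (scalar_scaleE _ _ _ _ (gl _)).
  rewrite (geodesic_speed_constant _ (metricP S) c _ 0 cg) -/E.
  rewrite [l * (l * E)]mulrA -expr2 sqr_sqrtr ?divr_ge0 ?mulr_ge0 ?ltW//.
  by rewrite divfK ?gt_eqF// mulKf // pnatr_eq0.
split=> [s t|].
  (* The shift [l * s] makes the curve start at [W (l * s)] at time 0. *)
  exists (fun u => c (l * u + l * s)); split; first exact: mag.
    by rewrite liftE mulr0 add0r.
  by rewrite liftE mulrDr addrC.
exists (T / l) => [|t]; first exact: divr_gt0.
rewrite mulrDr mulrCA divff ?gt_eqF// mulr1.
(* Scaling the fibre by [l] is a map of [TM S], so it carries the periodicity of the lift of [c]
   over to [W]. *)
exact: (congr1 (fun x : TM S => existT _ (projT1 x) (l *: projT2 x) : TM S)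
  (liftT (l * t))).
Qed.
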